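(* Let $\alpha\in(0,1)$ and let $T_\star=T_\star(\alpha)$ be the blow-up time of the solution $v$ of ${}^C D^\alpha_{0,+}v(t)=v^2(t)$, $v(0)=1$ (equivalently, of the solution $u(x,t)=-x\,v(t)$ of the time-fractional Burgers' equation ${}^C D^\alpha_{0,+}u+u\,\partial_x u=0$ with $u(x,0)=-x$), as defined in the context. Then $$T_\star\le\left(\frac{1}{\Gamma(2-\alpha)}\right)^{1/\alpha}.$$ In particular, for all $\alpha\in(0,1)$, $$T_\star\le e^{1-\gamma}=1.52620511\dots,$$ where $\gamma$ is the Euler-Mascheroni constant.
   Context: $\Gamma$ is the Euler Gamma function. For $\alpha\in(0,1)$, the left-Caputo-derivative with initial time $0$ is $${}^C D^\alpha_{0,+} f(t):=\frac{1}{\Gamma(1-\alpha)}\int_0^t\frac{\dot f(\tau)}{(t-\tau)^\alpha}\,d\tau,\qquad t>0.$$ Definition of $v$ and $T_\star$. For each integer $M\ge4$ let $f_M(r):=\min\{r^2,M^2\}$, $r\in\mathbb{R}$, and let $v_M:[0,+\infty)\to\mathbb{R}$ be the unique continuous solution of the Cauchy problem ${}^C D^\alpha_{0,+}v_M(t)=f_M(v_M(t))$ for $t>0$, $v_M(0)=1$, understood in the equivalent Volterra form $$v_M(t)=1+\frac{1}{\Gamma(\alpha)}\int_0^t\frac{f_M(v_M(\tau))}{(t-\tau)^{1-\alpha}}\,d\tau,\qquad t\ge0.$$ The functions $v_M$ are nondecreasing in $M$; set $v(t):=\lim_{M\to+\infty}v_M(t)=\sup_{M\ge4}v_M(t)\in[1,+\infty]$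 for $t\ge0$. The blow-up time $T_\star\in(0,+\infty]$ is the largest value such that $\sup_{t\in[0,T_0]}v(t)<+\infty$ for all $T_0\in(0,T_\star)$. On $[0,T_\star)$ the function $v$ is the continuous solution of ${}^C D^\alpha_{0,+}v(t)=v^2(t)$, $v(0)=1$, that is, $$v(t)=1+\frac{1}{\Gamma(\alpha)}\int_0^t\frac{v^2(\tau)}{(t-\tau)^{1-\alpha}}\,d\tau,\qquad t\in[0,T_\star).$$ *)

(* Defs.v *)
From HB Require Import structures.
From mathcomp Require Import all_boot all_order all_algebra.
From mathcomp Require Import all_classical all_reals all_analysis.

Set Implicit Arguments.
Unset Strict Implicit.
Unset Printing Implicit Defensive.

Import Order.TTheory GRing.Theory Num.Theory.
Import numFieldNormedType.Exports.

Local Open Scope classical_set_scope.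
Local Open Scope ring_scope.

Definition Gamma (R : realType) (z : R) : R :=
  \int[@lebesgue_measure R]_(x in `]0, +oo[) (x `^ (z - 1) * expR (- x)).

(* [series harmonic n] is 1 + 1/2 + ... + 1/n. *)
Definition euler_mascheroni (R : realType) : R :=
  limn (fun n : nat => series (@harmonic R) n - ln n%:R).

Definition trunc_sqr (R : realType) (M : nat) (r : R) : R :=
  Num.min (r ^+ 2) (M%:R ^+ 2).

(* The Cauchy problem for the Caputo equation of order alpha with right-hand
   side [trunc_sqr M] and initial value 1, in Volterra form.  Only the values
   of [w] on [0, +oo) matter.  At tau = t the integrand takes a conventional
   value (division by 0), which does not affect the integral. *)
Definition trunc_solution (R : realType) (alpha : R) (M : nat) (w : R -> R) :
    Prop :=
  {within `[0, +oo[, continuous w} /\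
  forall t : R, 0 <= t ->
    w t = 1 + (Gamma alpha)^-1 *
      \int[@lebesgue_measure R]_(tau in `[0, t])
        (trunc_sqr M (w tau) / (t - tau) `^ (1 - alpha)).

Definition sup_solution (R : realType) (vM : nat -> R -> R) (t : R) : \bar R :=
  ereal_sup [set (vM M t)%:E | M in [set M : nat | (4 <= M)%N]].

Definition bounded_before (R : realType) (v : R -> \bar R) (T : \bar R) :
    Prop :=
  forall T0 : R, 0 < T0 -> (T0%:E < T)%E ->
    (ereal_sup [set v t | t in `[0%R, T0]] < +oo)%E.

(* The supremum is a maximum: see [blowup_time_max]. *)
Definition blowup_time (R : realType) (v : R -> \bar R) : \bar R :=
  ereal_sup [set T : \bar R | (0 < T)%E /\ bounded_before v T].

Lemma blowup_time_max (R : realType) (v : R -> \bar R) :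
  (exists T : \bar R, (0 < T)%E /\ bounded_before v T) ->
  ((0 < blowup_time v)%E /\ bounded_before v (blowup_time v)) /\
  forall T : \bar R, (0 < T)%E -> bounded_before v T -> (T <= blowup_time v)%E.
Proof.
have ub T : (0 < T)%E -> bounded_before v T -> (T <= blowup_time v)%E.
  by move=> T0 Tv; apply: ereal_sup_ubound.
move=> [T [T0 Tv]]; split => //; split; first exact: lt_le_trans T0 (ub _ T0 Tv).
by move=> S S0 /ereal_sup_gt[U [U0 Uv] SU]; exact: Uv.
Qed.

(* Main.v *)
(* Write v for v_M on an interval [0, T] where v_M <= M, so that v solves the
   Volterra equation with v ^ 2, and let s = T - t.  Multiplying the equation by
   T - t and integrating over [0, T], Tonelli's theorem and the integral
   B(alpha, 2) = 1 / (alpha (alpha + 1)) give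
     int s v = T ^ 2 / 2 + k int s ^ (1 + alpha) v ^ 2,
   with 1 / k = alpha (alpha + 1) Gamma(alpha).  Young's inequality
     s v <= k s ^ (1 + alpha) v ^ 2 + s ^ (1 - alpha) / (4 k)
   then cancels the quadratic term and leaves
     T ^ alpha <= (alpha + 1) Gamma(1 + alpha) / (2 (2 - alpha)),
   which is at most 1 / Gamma(2 - alpha) because Gamma <= 1 on [1, 2].  So no T
   beyond the announced bound is a time before blow-up.

   Log-convexity of Gamma yields n! <= (n + 1) ^ alpha Gamma(n + 1 - alpha);
   writing Gamma(n + 1 - alpha) as Gamma(2 - alpha) times a product of factors
   j - alpha <= j exp(- alpha / j) and letting n tend to infinity gives
   Gamma(2 - alpha) >= exp(- alpha (1 - gamma)), hence the second bound.

   The digits of exp(1 - gamma) come from monotone Euler-Maclaurin lower and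
   upper approximations of gamma evaluated at n = 10; both their monotonicity
   and the numerical value of ln 10 rest on truncating
   ln ((1 + x) / (1 - x)) = 2 (x + x ^ 3 / 3 + x ^ 5 / 5 + ...). *)
Require Import Defs.
From mathcomp Require Import all_boot all_order all_algebra.
From mathcomp Require Import all_classical all_reals all_analysis.
From mathcomp Require Import measurable_realfun.
From mathcomp Require Import ring lra.

Set Implicit Arguments.
Unset Strict Implicit.
Unset Printing Implicit Defensive.

Import Order.TTheory GRing.Theory Num.Theory.
Import numFieldNormedType.Exports.

Local Open Scope classical_set_scope.
Local Open Scope ring_scope.

(** * Logarithm bounds *)

Section log_bounds.
Context {R : realType}.
Implicit Types (x c : R) (k n : nat).

Implicit Types y : R.

(** Truncated Taylor series of [artanh]; logarithms enter through
    [ln (1 + x) - ln (1 - x) = 2 artanh x]. *)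
Definition artanh_poly k x : R := \sum_(i < k) x ^+ i.*2.+1 / i.*2.+1%:R.

Lemma is_derive_artanh_poly k x :
  is_derive x 1 (artanh_poly k) (\sum_(i < k) x ^+ i.*2).
Proof.
rewrite (_ : artanh_poly k =
    \sum_(i < k) (i.*2.+1%:R^-1 \*: (fun y => y ^+ i.*2.+1))); last first.
  apply/funext => y; rewrite fct_sumE /artanh_poly.
  by apply: eq_bigr => i _; rewrite /= mulrC.
apply: is_derive_sum => i.
have d : is_derive x 1 (fun y : R => y ^+ i.*2.+1) (i.*2.+1%:R * x ^+ i.*2).
  by split; [exact: exprn_derivable|rewrite exp_derive scaler1].
apply: is_derive_eq.
by rewrite /GRing.scale/= mulrA mulVf ?mul1r// pnatr_eq0.
Qed.

Lemma is_derive_artanh x : 0 <= x < 1 ->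
  is_derive x 1 (fun y => ln (1 + y) - ln (1 - y)) (2 / (1 - x ^+ 2)).
Proof.
move=> /andP[x0 x1].
have d1 : is_derive (1 + x) 1 (@ln R) (1 + x)^-1 by apply: is_derive1_ln; lra.
have d2 : is_derive (1 - x) 1 (@ln R) (1 - x)^-1 by apply: is_derive1_ln; lra.
have e1 : is_derive x 1 (fun y : R => 1 + y) 1.
  by rewrite -[X in is_derive _ _ _ X]add0r;
    exact: (is_deriveD (is_derive_cst _ _ _) (is_derive_id x 1)).
have e2 : is_derive x 1 (fun y : R => 1 - y) (-1).
  by rewrite -[X in is_derive _ _ _ X]sub0r;
    exact: (is_deriveB (is_derive_cst _ _ _) (is_derive_id x 1)).
have f1 := @is_derive1_comp R (@ln R) (fun y => 1 + y) x _ _ d1 e1.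
have f2 := @is_derive1_comp R (@ln R) (fun y => 1 - y) x _ _ d2 e2.
apply: is_derive_eq (is_deriveB f1 f2) _ => //.
field; apply/and3P; split; apply: lt0r_neq0; nra.
Qed.

Lemma sum_sqr_pow k x : x ^+ 2 != 1 ->
  \sum_(i < k) x ^+ i.*2 = (1 - x ^+ k.*2) / (1 - x ^+ 2).
Proof.
move=> x1; apply: (canRL (mulfK _)); first by rewrite subr_eq0 eq_sym.
elim: k => [|k IH]; first by rewrite big_ord0 mul0r subrr.
rewrite big_ord_recr/= mulrDl IH doubleS !(exprS _ k.*2.+1, exprS _ k.*2).
ring.
Qed.

(** The gap vanishes at [0] and, by the geometric sum, has derivative
    [2 x ^ (2 k) / (1 - x ^ 2) >= 0]. *)
Lemma artanh_poly_le k x : 0 <= x < 1 ->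
  2 * artanh_poly k x <= ln (1 + x) - ln (1 - x).
Proof.
move=> /andP[x0 x1].
pose f (y : R) := ln (1 + y) - ln (1 - y) - 2 * artanh_poly k y.
have fd (y : R) : 0 <= y < 1 ->
    is_derive y 1 f (2 / (1 - y ^+ 2) - 2 * \sum_(i < k) y ^+ i.*2).
  move=> y01; apply: is_deriveB; first exact: is_derive_artanh.
  exact: (is_deriveZ _ (is_derive_artanh_poly k y)).
suff : f 0 <= f x.
  rewrite /f addr0 subr0 subrr /artanh_poly big1 ?mulr0 ?subr0 ?subr_ge0//.
  by move=> i _; rewrite exprS !mul0r.
have [c|c|->] := ltgtP 0 x; [|lra|by []].
have [||d] := @MVT R f (fun y => 2 / (1 - y ^+ 2) - 2 * \sum_(i < k) y ^+ i.*2) 0 x c.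
- by move=> y; rewrite in_itv/= => /andP[y0 yx]; apply: fd; lra.
- apply: derivable_within_continuous => y; rewrite in_itv/= => /andP[y0 yx].
  by apply: (@ex_derive _ _ _ _ _ _ _ (fd y _)); lra.
rewrite in_itv/= subr0 => /andP[d0 dx] e.
rewrite -subr_ge0 e mulr_ge0//.
have d1 : 0 < 1 - d ^+ 2 by nra.
rewrite sum_sqr_pow; last by rewrite -subr_eq0 -oppr_eq0 opprB gt_eqF.
rewrite mulrA -mulrBl divr_ge0 ?(ltW d1)//.
have : 0 <= d ^+ k.*2 by rewrite exprn_ge0// ltW.
lra.
Qed.

(** For [y <= x] the derivative of the remainder is at most [2 y ^ (2 k) / (1 - x ^ 2)], whose
    primitive is the added term. *)
Lemma artanh_poly_ge k x : 0 <= x < 1 ->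
  ln (1 + x) - ln (1 - x) <=
  2 * (artanh_poly k x + x ^+ k.*2.+1 / k.*2.+1%:R / (1 - x ^+ 2)).
Proof.
move=> /andP[x0 x1].
(* The denominator is frozen at the endpoint [x], so that [F] is a polynomial. Its last term is a
   difference of two consecutive [artanh_poly], whose derivatives are known. *)
pose C := (1 - x ^+ 2)^-1.
pose F (y : R) := artanh_poly k y + C * (artanh_poly k.+1 y - artanh_poly k y).
pose f (y : R) := 2 * F y - (ln (1 + y) - ln (1 - y)).
have fE y : F y = artanh_poly k y + y ^+ k.*2.+1 / k.*2.+1%:R * C.
  rewrite /F [in artanh_poly k.+1 y]/artanh_poly big_ord_recr/=
    -/(artanh_poly k y).
  ring.
have fd (y : R) : 0 <= y < 1 ->
    is_derive y 1 f (2 * (\sum_(i < k) y ^+ i.*2 + C * y ^+ k.*2) - 2 / (1 - y ^+ 2)).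
  move=> y01; apply: is_deriveB; last exact: is_derive_artanh.
  apply: (is_deriveZ 2); apply: is_deriveD.
    exact: is_derive_artanh_poly.
  apply: (is_deriveZ C); rewrite (_ : y ^+ k.*2 =
    \sum_(i < k.+1) y ^+ i.*2 - \sum_(i < k) y ^+ i.*2); last first.
    by rewrite big_ord_recr/=; ring.
  by apply: is_deriveB; exact: is_derive_artanh_poly.
rewrite -(fE x) -subr_ge0 -/(f x).
have f0 : f 0 = 0.
  rewrite /f /F addr0 subr0 subrr /artanh_poly !big1 ?subr0 ?mulr0 ?addr0
    ?mulr0//.
  - by move=> i _; rewrite exprS !mul0r.
  - by move=> i _; rewrite exprS !mul0r.
rewrite -{}f0.
have [c|c|->] := ltgtP 0 x; [|lra|by []].
have [||d] := @MVT R f (fun y => 2 * (\sum_(i < k) y ^+ i.*2 + C * y ^+ k.*2)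
    - 2 / (1 - y ^+ 2)) 0 x c.
- by move=> y; rewrite in_itv/= => /andP[y0 yx]; apply: fd; lra.
- apply: derivable_within_continuous => y; rewrite in_itv/= => /andP[y0 yx].
  by apply: (@ex_derive _ _ _ _ _ _ _ (fd y _)); lra.
rewrite in_itv/= subr0 => /andP[d0 dx] e.
rewrite -subr_ge0 e mulr_ge0//.
have d1 : 0 < 1 - d ^+ 2 by nra.
have x2 : 0 < 1 - x ^+ 2 by nra.
rewrite sum_sqr_pow; last by rewrite -subr_eq0 -oppr_eq0 opprB gt_eqF.
have CD : (1 - d ^+ 2)^-1 <= C by rewrite lef_pV2 ?posrE//; nra.
have dk : 0 <= d ^+ k.*2 by rewrite exprn_ge0// ltW.
set D := (1 - d ^+ 2)^-1 in CD *.
have : D * d ^+ k.*2 <= C * d ^+ k.*2 by exact: ler_wpM2r.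
lra.
Qed.

End log_bounds.

(** * Bounds on the Euler-Mascheroni constant *)

Section euler_mascheroni_bounds.
Context {R : realType}.
Implicit Types (x : R) (n : nat).

Definition euler_seq n : R := series (@harmonic R) n - ln n%:R.

(* The first correction terms of the Euler-Maclaurin expansion of
   [euler_seq n], at [x = n]. *)
Definition euler_corr x : R :=
  (2 * x)^-1 - (12 * x ^+ 2)^-1 + (120 * x ^+ 4)^-1.

Definition euler_lo n : R := euler_seq n - euler_corr n%:R.

(** The next Euler-Maclaurin term has the opposite effect on monotonicity: [euler_lo] increases to
    the constant and [euler_hi] decreases to it, from [n = 1] on. *)
Definition euler_hi n : R := euler_lo n + (252 * n%:R ^+ 6)^-1.

(** With [u = 1 / (2 x + 1)] one has [(1 + u) / (1 - u) = (x + 1) / x]. *)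
Lemma lnS_artanh x : 0 < x -> ln (x + 1) - ln x =
  ln (1 + (2 * x + 1)^-1) - ln (1 - (2 * x + 1)^-1).
Proof.
move=> x0.
have -> : 1 + (2 * x + 1)^-1 = (2 * (x + 1)) / (2 * x + 1).
  by field; rewrite lt0r_neq0//; lra.
have -> : 1 - (2 * x + 1)^-1 = (2 * x) / (2 * x + 1).
  by field; rewrite lt0r_neq0//; lra.
rewrite !ln_div ?posrE; try lra.
by rewrite !lnM ?posrE; lra.
Qed.

(** At [x = n] this says that [euler_lo] increases from [n] to [n + 1]. Three terms of the [artanh]
    series reduce it to an inequality between rational functions. *)
Lemma lnS_le x : 0 < x -> ln (x + 1) - ln x <=
  (x + 1)^-1 - (euler_corr (x + 1) - euler_corr x).
Proof.
move=> x0; rewrite lnS_artanh//.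
have h : 0 <= (2 * x + 1)^-1 < 1.
  by rewrite invr_ge0 invf_lt1 ?andbT; lra.
apply: le_trans (artanh_poly_ge 3 h) _.
rewrite -subr_ge0 /artanh_poly !big_ord_recr big_ord0/= !doubleS double0
  /euler_corr.
have x1 : x != 0 by rewrite gt_eqF.
have x2 : x + 1 != 0 by rewrite gt_eqF//; lra.
have x3 : 2 * x + 1 != 0 by rewrite gt_eqF//; lra.
(* Over a common denominator the numerator has only positive coefficients, which settles the sign
   for [x > 0]. *)
rewrite [leRHS](_ : _ = (7 + 98 * x + 532 * x ^+ 2 + 1508 * x ^+ 3 +
   2354 * x ^+ 4 + 1920 * x ^+ 5 + 640 * x ^+ 6) /
  (840 * x ^+ 4 * (x + 1) ^+ 4 * (2 * x + 1) ^+ 5)).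
  have P k : 0 <= x ^+ k by exact/exprn_ge0/ltW.
  apply: divr_ge0.
    by have := (P 1, P 2, P 3, P 4, P 5, P 6);
      rewrite !expr1 => -[[[[[? ?] ?] ?] ?] ?]; lra.
  apply: mulr_ge0; last by apply: exprn_ge0; lra.
  apply: mulr_ge0; last by apply: exprn_ge0; lra.
  by apply: mulr_ge0; [lra|exact: P].
by field; rewrite x1 x2 x3 gt_eqF//; nra.
Qed.

(** At [x = n] this says that [euler_hi] decreases from [n] to [n + 1]; four terms of the series are
    kept. *)
Lemma lnS_ge x : 0 < x ->
  (x + 1)^-1 - (euler_corr (x + 1) - euler_corr x) + (252 * (x + 1) ^+ 6)^-1
    - (252 * x ^+ 6)^-1 <= ln (x + 1) - ln x.
Proof.
move=> x0; rewrite lnS_artanh//.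
have h : 0 <= (2 * x + 1)^-1 < 1.
  by rewrite invr_ge0 invf_lt1 ?andbT; lra.
apply: le_trans (artanh_poly_le 4 h).
rewrite -subr_ge0 /artanh_poly !big_ord_recr big_ord0/= !doubleS double0
  /euler_corr.
have x1 : x != 0 by rewrite gt_eqF.
have x2 : x + 1 != 0 by rewrite gt_eqF//; lra.
have x3 : 2 * x + 1 != 0 by rewrite gt_eqF//; lra.
(* Again all coefficients are positive; the larger ones are split, as [97 * 100 + 20] for 9720. *)
rewrite [leRHS](_ : _ = (10 + 200 * x + 1809 * x ^+ 2 + (97 * 100 + 20) * x ^+ 3 +
   (343 * 100 + 17) * x ^+ 4 + (829 * 100 + 26) * x ^+ 5 +
   (1387 * 100 + 74) * x ^+ 6 + (1589 * 100 + 28) * x ^+ 7 +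
   (1193 * 100 + 22) * x ^+ 8 + (530 * 100 + 60) * x ^+ 9 +
   (106 * 100 + 12) * x ^+ 10) /
  (2520 * x ^+ 6 * (x + 1) ^+ 6 * (2 * x + 1) ^+ 7)).
  have P k : 0 <= x ^+ k by exact/exprn_ge0/ltW.
  apply: divr_ge0.
    by have := (P 1, P 2, P 3, P 4, P 5, (P 6, P 7, P 8, P 9, P 10));
      rewrite !expr1 => -[[[[[? ?] ?] ?] ?] [[[[? ?] ?] ?] ?]]; lra.
  apply: mulr_ge0; last by apply: exprn_ge0; lra.
  apply: mulr_ge0; last by apply: exprn_ge0; lra.
  by apply: mulr_ge0; [lra|exact: P].
by field; rewrite x1 x2 x3.
Qed.

Lemma euler_seqS n : euler_seq n.+1 =
  euler_seq n + (n%:R + 1)^-1 - (ln (n%:R + 1) - ln n%:R).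
Proof. by rewrite /euler_seq seriesSr/= -(natr1 n); ring. Qed.

Lemma euler_lo_le n m : (0 < n <= m)%N -> euler_lo n <= euler_lo m.
Proof.
move=> /andP[n0]; elim: m => [|m IH]; first by case: n n0.
rewrite leq_eqVlt => /predU1P[->//|]; rewrite ltnS => nm.
apply: le_trans (IH nm) _.
have m0 : 0 < m%:R :> R by rewrite ltr0n (leq_trans n0).
have := lnS_le m0.
by rewrite /euler_lo euler_seqS -(natr1 m); lra.
Qed.

Lemma euler_hi_ge n m : (0 < n <= m)%N -> euler_hi m <= euler_hi n.
Proof.
move=> /andP[n0]; elim: m => [|m IH]; first by case: n n0.
rewrite leq_eqVlt => /predU1P[->//|]; rewrite ltnS => nm.
apply: le_trans (IH nm).
have m0 : 0 < m%:R :> R by rewrite ltr0n (leq_trans n0).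
have := lnS_ge m0.
by rewrite /euler_hi /euler_lo euler_seqS -(natr1 m); lra.
Qed.

Lemma euler_corr_ge0 x : 1 <= x -> 0 <= euler_corr x.
Proof.
move=> x1; rewrite /euler_corr.
have x0 : 0 < x by lra.
have : (12 * x ^+ 2)^-1 <= (2 * x)^-1.
  by rewrite lef_pV2 ?posrE; nra.
have : 0 <= (120 * x ^+ 4)^-1.
  by rewrite invr_ge0 mulr_ge0 ?ler0n// exprn_ge0// ltW.
lra.
Qed.

Lemma euler_corr_le x : 1 <= x -> euler_corr x <= x^-1.
Proof.
move=> x1; rewrite /euler_corr.
have x0 : 0 < x by lra.
have : (120 * x ^+ 4)^-1 <= (12 * x ^+ 2)^-1.
  rewrite lef_pV2 ?posrE ?mulr_gt0 ?exprn_gt0//.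
  rewrite (exprD x 2 2) mulrA ler_wpM2r ?exprn_ge0 ?(ltW x0)//; nra.
have : (2 * x)^-1 <= x^-1 by rewrite lef_pV2 ?posrE ?mulr_gt0//; lra.
lra.
Qed.

Lemma euler_lo_le_seq n : (0 < n)%N -> euler_lo n <= euler_seq n.
Proof.
by move=> n0; rewrite lerBlDr lerDl euler_corr_ge0// ler1n.
Qed.

(** The sequence is nonincreasing from [n = 1] on and bounded below by [euler_lo 1]. Convergence
    gives the [limn] in the definition of the constant its meaning. *)
Lemma cvg_euler_seq : euler_seq n @[n --> \oo] --> euler_mascheroni R.
Proof.
(* The shift avoids [euler_seq 0], which is [0] by the convention [ln 0 = 0] and breaks
   monotonicity. *)
suff : cvgn (fun n => euler_seq n.+1).
  by move=> /cvg_ex[l]; rewrite (cvg_shiftS euler_seq) => /cvgP.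
apply: nonincreasing_is_cvgn.
  apply/nonincreasing_seqP => n; rewrite euler_seqS.
  have n0 : 0 < n.+1%:R :> R by rewrite ltr0n.
  suff : (n.+1%:R + 1)^-1 <= ln (n.+1%:R + 1) - ln n.+1%:R :> R by lra.
  set x : R := n.+1%:R in n0 *.
  have x1 : 0 < x + 1 by lra.
  rewrite -opprB -ln_div ?posrE// lerNr.
  rewrite [X in ln X](_ : _ = 1 - (x + 1)^-1); last first.
    by field; rewrite gt_eqF.
  apply: le_ln1Dx; rewrite ltrN2 invf_lt1//; lra.
exists (euler_lo 1) => _ [n _ <-].
exact: le_trans (euler_lo_le _) (euler_lo_le_seq _).
Qed.

Lemma euler_lo_le_lim n : (0 < n)%N -> euler_lo n <= euler_mascheroni R.
Proof.
move=> n0; apply: (cvgr_to_ge cvg_euler_seq).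
near=> m.
have nm : (n <= m)%N by near: m; exact: nbhs_infty_ge.
apply: le_trans (euler_lo_le _) (euler_lo_le_seq _); first by rewrite n0.
exact: leq_trans nm.
Unshelve. all: by end_near. Qed.

Lemma euler_hi_ge_lim n : (0 < n)%N -> euler_mascheroni R <= euler_hi n.
Proof.
move=> n0.
(* [harmonic m = 1 / (m + 1)] dominates [euler_corr] at [m + 1]. The sequence thus stays below
   [euler_hi m.+1], and its limit is the constant. *)
have c : euler_seq m.+1 - harmonic m @[m --> \oo] --> euler_mascheroni R.
  rewrite -[X in _ --> X]subr0; apply: cvgB; last exact: cvg_harmonic.
  by rewrite (cvg_shiftS euler_seq); exact: cvg_euler_seq.
apply: (cvgr_to_le c).
near=> m.
have nm : (n <= m.+1)%N by apply: leqW; near: m; exact: nbhs_infty_ge.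
apply: le_trans (euler_hi_ge (m := m.+1) _); last by rewrite n0.
rewrite /euler_hi /euler_lo.
have := @euler_corr_le m.+1%:R; rewrite ler1n => /(_ isT) /= h.
have : 0 <= (252 * m.+1%:R ^+ 6)^-1 :> R.
  by rewrite invr_ge0 mulr_ge0 ?ler0n// exprn_ge0.
by move=> y0; apply: ler_wpDr => //; rewrite lerD2l lerN2.
Unshelve. all: by end_near. Qed.

End euler_mascheroni_bounds.

(** * Numerical evaluation of the logarithms and of [exp (1 - gamma)] *)

Section decimals.
Context {R : realType}.

Lemma artanh_polyS k (x : R) : artanh_poly k.+1 x =
  artanh_poly k x + x ^+ k.*2.+1 / k.*2.+1%:R.
Proof. by rewrite /artanh_poly big_ord_recr. Qed.

Lemma artanh_poly0 (x : R) : artanh_poly 0 x = 0.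
Proof. by rewrite /artanh_poly big_ord0. Qed.

(** On [[0, 1/2]] the factor [1 / (1 - x ^ 2)] is at most [4 / 3], which leaves a polynomial
    bound. *)
Lemma artanh_poly_ge_half k (x : R) : 0 <= x <= 2^-1 ->
  ln (1 + x) - ln (1 - x) <=
  2 * (artanh_poly k x + x ^+ k.*2.+1 / k.*2.+1%:R * (4 / 3)).
Proof.
move=> /andP[x0 x2].
have x1 : 0 <= x < 1 by lra.
apply: le_trans (artanh_poly_ge k x1) _.
rewrite ler_pM2l// lerD2l ler_wpM2l//; first by rewrite divr_ge0// exprn_ge0.
have -> : 4 / 3 = (3 / 4 : R)^-1 by field.
by rewrite lef_pV2 ?posrE; nra.
Qed.

Lemma ln_le_artanh k (x z : R) : 0 <= x <= 2^-1 -> 0 < z ->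
  z * (1 - x) <= 1 + x ->
  ln z <= 2 * (artanh_poly k x + x ^+ k.*2.+1 / k.*2.+1%:R * (4 / 3)).
Proof.
move=> x12 z0 zx; apply: le_trans (artanh_poly_ge_half k x12).
rewrite -ln_div ?posrE; try lra.
by rewrite ler_ln ?posrE ?divr_gt0// ?ler_pdivlMr//; lra.
Qed.

Lemma ln_ge_artanh k (x z : R) : 0 <= x < 1 -> 1 + x <= z * (1 - x) ->
  2 * artanh_poly k x <= ln z.
Proof.
move=> x1 zx; apply: le_trans (artanh_poly_le k x1) _.
rewrite -ln_div ?posrE; try lra.
have z0 : 0 < z by nra.
by rewrite ler_ln ?posrE ?divr_gt0// ?ler_pdivrMr//; lra.
Qed.

Lemma ln2_bounds : 6931471805%:R / 10 ^+ 10 <= ln (2 : R) <= 6931471806%:R /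
  10 ^+ 10.
Proof.
apply/andP; split.
  (* The point [1/3] is the solution of [(1 + x) / (1 - x) = 2]. *)
  apply: le_trans (ln_ge_artanh 10 (x := 3^-1) _ _); [|lra|lra].
  by rewrite !artanh_polyS artanh_poly0 !doubleS double0; lra.
apply: le_trans (ln_le_artanh 10 (x := 3^-1) _ _ _) _; [lra|lra|lra|].
by rewrite !artanh_polyS artanh_poly0 !doubleS double0; lra.
Qed.

Lemma harmonic10 : series (@harmonic R) 10 =
  1 + 2^-1 + 3^-1 + 4^-1 + 5^-1 + 6^-1 + 7^-1 + 8^-1 + 9^-1 + 10^-1.
Proof.
by rewrite /series/= /index_iota/= !big_cons big_nil; lra.
Qed.

Lemma euler_lo10 : euler_lo 10 =
  1 + 2^-1 + 3^-1 + 4^-1 + 5^-1 + 6^-1 + 7^-1 + 8^-1 + 9^-1 + 10^-1 - ln 10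
  - (20^-1 - 1200^-1 + 1200^-1 / 1000) :> R.
Proof. by rewrite /euler_lo /euler_seq harmonic10 /euler_corr; field. Qed.

Lemma euler_hi10 : euler_hi 10 = euler_lo 10 + 252^-1 / 10 ^+ 6 :> R.
Proof. by rewrite /euler_hi; field. Qed.

(* The factor [8 / 10] brings the argument close to [1]; it costs
   [ln 10 - 3 * ln 2]. *)
Lemma ln_lower_digits_le : ln (152620511%:R / 10 ^+ 8 * 8 / 10 : R) <=
  19964078276%:R / 10 ^+ 11.
Proof.
(* The point is [(z - 1) / (z + 1)] for the argument [z] of the logarithm, rounded upwards; the
   companion lower bound rounds downwards. *)
apply: le_trans (ln_le_artanh 5 (x := 9949016700%:R / 10 ^+ 11) _ _ _) _;
  [lra|lra|lra|].
by rewrite !artanh_polyS artanh_poly0 !doubleS double0; lra.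
Qed.

Lemma ln_upper_digits_ge : 19964078869%:R / 10 ^+ 11 <= ln
  (152620512%:R / 10 ^+ 8 * 8 / 10 : R).
Proof.
apply: le_trans (ln_ge_artanh 5 (x := 9949017023%:R / 10 ^+ 11) _ _);
  [|lra|lra].
by rewrite !artanh_polyS artanh_poly0 !doubleS double0; lra.
Qed.

Lemma expR_1Beuler :
  152620511%:R / 10 ^+ 8 <= expR (1 - euler_mascheroni R)
    < 152620512%:R / 10 ^+ 8.
Proof.
have [l1 l2] := andP ln2_bounds.
(* The [ln 10] produced by this rescaling cancels the one in [euler_lo 10], so only [ln 2] has to be
   evaluated. *)
have ln10 (c : R) : 0 < c -> ln c = ln (c * 8 / 10) + ln 10%:R - 3 * ln 2.
  move=> c0.
  have -> : 3 * ln (2 : R) = ln (8 : R) by rewrite mulr_natl -lnXn// -natrX.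
  by rewrite ln_div ?posrE ?mulr_gt0// lnM ?posrE//; lra.
apply/andP; split.
  rewrite -[leLHS]lnK ?posrE; last lra.
  rewrite ler_expR.
  have := @euler_hi_ge_lim R 10 isT; rewrite euler_hi10 euler_lo10.
  by rewrite (ln10 (_ / _)); [have := ln_lower_digits_le; lra|lra].
rewrite -[ltRHS]lnK ?posrE; last lra.
rewrite ltr_expR.
have := @euler_lo_le_lim R 10 isT; rewrite euler_lo10.
by rewrite (ln10 (_ / _)); [have := ln_upper_digits_ge; lra|lra].
Qed.
End decimals.

(** * Improper integrals and Tonelli's theorem on a triangle *)

Section improper_integrals.
Context {R : realType}.
Notation mu := (@lebesgue_measure R).
Implicit Types (f F : R -> R) (a b l m x t : R).

(** The integrand may be unbounded at both ends. The interval is exhausted by compact ones, where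
    the usual theorem applies, and monotone convergence passes to the limit. *)
Lemma ge0_FTC2_oo f F a b l m : a < b ->
  {in `]a, b[, forall x, 0 <= f x} ->
  {in `]a, b[, continuous f} ->
  {in `]a, b[, forall x, is_derive x 1 F (f x)} ->
  F x @[x --> a^'+] --> l -> F x @[x --> b^'-] --> m ->
  (\int[mu]_(x in `]a, b[) (f x)%:E = (m - l)%:E)%E.
Proof.
move=> ab f0 cf dF Fa Fb.
(* The divisor [3] keeps [a + d n < b - d n] for every [n]. *)
pose d n : R := (b - a) / 3 / n.+1%:R.
have d0 n : 0 < d n by rewrite !divr_gt0// subr_gt0.
have d3 n : d n <= (b - a) / 3.
  by rewrite /d ler_pdivrMr// ler_peMr ?ler1n// divr_ge0// subr_ge0 ltW.
have dc : d n @[n --> \oo] --> 0.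
  rewrite -[X in _ --> X](mulr0 ((b - a) / 3)).
  by apply: cvgM; [exact: cvg_cst|exact: cvg_harmonic].
have dle n k : (n <= k)%N -> d k <= d n.
  move=> nk; rewrite /d ler_wpM2l ?divr_ge0 ?subr_ge0 ?(ltW ab)//.
  by rewrite lef_pV2 ?posrE// ler_nat ltnS.
clearbody d.
pose D n := `[a + d n, b - d n]%classic.
have Dab n : D n `<=` `]a, b[%classic.
  rewrite /D => x /=; rewrite !in_itv/= => /andP[? ?].
  by have ? := d0 n; apply/andP; split; lra.
have UD : \bigcup_n D n = `]a, b[%classic.
  apply/seteqP; split=> [x [n _ /Dab]//|x /=]; rewrite in_itv/= => /andP[ax xb].
  have e0 : 0 < Num.min (x - a) (b - x) by rewrite lt_min !subr_gt0 ax.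
  have /cvgrPdist_lt /(_ _ e0) [n _ /(_ n (leqnn n))] := dc.
  rewrite /= sub0r normrN gtr0_norm// lt_min => /andP[? ?].
  by exists n => //; rewrite /D/= in_itv/=; apply/andP; split; lra.
have intD n : (\int[mu]_(x in D n) (f x)%:E = (F (b - d n) - F (a + d n))%:E)%E.
  have abn : a + d n < b - d n by have := d3 n; lra.
  have cD x : x \in `[a + d n, b - d n] -> x \in `]a, b[.
    by move=> xD; apply: (Dab n).
  rewrite (@continuous_FTC2 R f F)//.
  - apply: continuous_in_subspaceT => x; rewrite inE => xD.
    by apply: cf; exact: cD.
  - have Fd : {in `[a + d n, b - d n], forall x, derivable F x 1}.
      by move=> x xD; apply: (@ex_derive _ _ _ _ _ _ _ (dF x (cD x xD))).
    have /(continuous_within_itvP _ abn)[_ ? ?] :=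
      derivable_within_continuous Fd.
    split => // x xD; apply: Fd; exact: subset_itv_oo_cc xD.
  - move=> x xD; rewrite derive1E.
    by apply: (@derive_val _ _ _ _ _ _ _ (dF x _)); apply: cD;
      exact: subset_itv_oo_cc xD.
rewrite -UD.
have : ((\int[mu]_(x in D n) (f x)%:E) @[n --> \oo] -->
    \int[mu]_(x in \bigcup_i D i) (f x)%:E)%E.
  apply: ge0_nondecreasing_set_cvg_integral.
  - move=> n k nk; rewrite subsetEset /D => x/=;
      rewrite !in_itv/= => /andP[? ?].
    by have ? := dle _ _ nk; apply/andP; split; lra.
  - by move=> n; exact: measurable_itv.
  - move=> n; apply/measurable_EFinP; apply: measurable_funS (Dab n) _ => //.
    apply: open_continuous_measurable_fun; first exact: interval_open.
    by move=> x; rewrite inE; exact: cf.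
  - by move=> n x /Dab xab; rewrite lee_fin; exact: f0.
under eq_fun do rewrite intD.
move=> /cvg_unique; apply => //.
apply: cvg_EFin; first exact: nearW.
apply: cvgB.
  move/cvg_at_leftP : Fb; apply; split; first by move=> n;
    rewrite ltrBlDr ltrDl.
  by rewrite -[X in _ --> X]subr0; apply: cvgB => //; exact: cvg_cst.
move/cvg_at_rightP : Fa; apply; split; first by move=> n; rewrite ltrDl.
by rewrite -[X in _ --> X]addr0; apply: cvgD => //; exact: cvg_cst.
Qed.
End improper_integrals.

(** * Explicit integrals of powers and exponentials *)

Section elementary_integrals.
Context {R : realType}.
Notation mu := (@lebesgue_measure R).
Implicit Types (f F : R -> R) (a b l m r s t x : R).

Lemma cvg_at_right_subr f a l : f x @[x --> 0^'+] --> l ->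
  f (x - a) @[x --> a^'+] --> l.
Proof.
move=> fl; apply/cvg_at_rightP => u [ua cu].
move/cvg_at_rightP : fl; apply; split; first by move=> n; rewrite subr_gt0.
by rewrite -(subrr a); apply: cvgB => //; exact: cvg_cst.
Qed.

Lemma cvg_at_left_subl f a l : f x @[x --> 0^'+] --> l ->
  f (a - x) @[x --> a^'-] --> l.
Proof.
move=> fl; apply/cvg_at_leftP => u [ua cu].
move/cvg_at_rightP : fl; apply; split; first by move=> n; rewrite subr_gt0.
by rewrite -(subrr a); apply: cvgB => //; exact: cvg_cst.
Qed.

Lemma continuous_powR r x : 0 < x -> {for x, continuous (fun y => y `^ r)}.
Proof.
move=> x0; apply/differentiable_continuous/derivable1_diffP.
by apply: derivable_powR; rewrite in_itv/= x0.
Qed.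

Lemma is_derive_powR_subr r a x : a < x ->
  is_derive x 1 (fun y => (y - a) `^ r) (r * (x - a) `^ (r - 1)).
Proof.
move=> ax; have d1 : is_derive (x - a) 1 (fun y => y `^ r)
  (r * (x - a) `^ (r - 1)).
  by apply: is_derive1_powR; rewrite subr_gt0.
have d2 : is_derive x 1 (fun y : R => y - a) 1.
  by rewrite -[X in is_derive _ _ _ X]subr0;
    exact: (is_deriveB (is_derive_id x 1) (is_derive_cst _ _ _)).
apply: is_derive_eq (@is_derive1_comp R (fun y => y `^ r) (fun y => y - a) x _ _ d1 d2) _.
by rewrite mulr1.
Qed.

Lemma is_derive_powR_subl r a x : x < a ->
  is_derive x 1 (fun y => (a - y) `^ r) (- (r * (a - x) `^ (r - 1))).
Proof.
move=> ax; have d1 : is_derive (a - x) 1 (fun y => y `^ r)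
  (r * (a - x) `^ (r - 1)).
  by apply: is_derive1_powR; rewrite subr_gt0.
have d2 : is_derive x 1 (fun y : R => a - y) (-1).
  by rewrite -[X in is_derive _ _ _ X]sub0r;
    exact: (is_deriveB (is_derive_cst _ _ _) (is_derive_id x 1)).
apply: is_derive_eq (@is_derive1_comp R (fun y => y `^ r) (fun y => a - y) x _ _ d1 d2) _.
by rewrite mulrN1.
Qed.

Lemma continuous_powR_subr r a x : a < x ->
  {for x, continuous (fun y => (y - a) `^ r)}.
Proof.
move=> ax; apply/differentiable_continuous/derivable1_diffP.
exact: (@ex_derive _ _ _ _ _ _ _ (is_derive_powR_subr r ax)).
Qed.

Lemma continuous_powR_subl r a x : x < a ->
  {for x, continuous (fun y => (a - y) `^ r)}.
Proof.
move=> ax; apply/differentiable_continuous/derivable1_diffP.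
exact: (@ex_derive _ _ _ _ _ _ _ (is_derive_powR_subl r ax)).
Qed.

Lemma integral_powR r s : 0 < r -> 0 < s ->
  (\int[mu]_(t in `]0%R, s[) (r * t `^ (r - 1))%R%:E = (s `^ r)%R%:E)%E.
Proof.
move=> r0 s0; rewrite -[in RHS](subr0 (s `^ r)).
apply: (@ge0_FTC2_oo R (fun t => r * t `^ (r - 1)) (fun t => t `^ r)) => //.
- by move=> t _; rewrite mulr_ge0 ?powR_ge0// ltW.
- move=> t; rewrite in_itv/= => /andP[t0 _].
  by apply: cvgM; [exact: cvg_cst|exact: continuous_powR].
- move=> t; rewrite in_itv/= => /andP[t0 _].
  exact: is_derive1_powR.
- exact: powR_cvg0.
- by apply: cvg_at_left_filter; exact: continuous_powR.
Qed.

Lemma integral_powR_subl r t : 0 < r -> 0 < t ->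
  (\int[mu]_(tau in `]0%R, t[) (r * (t - tau) `^ (r - 1))%R%:E = (t `^ r)%R%:E)%E.
Proof.
move=> r0 t0; have -> : t `^ r = 0 - - ((t - 0) `^ r)
  by rewrite subr0 sub0r opprK.
apply: (@ge0_FTC2_oo R (fun x => r * (t - x) `^ (r - 1)) (fun x => - ((t - x) `^ r)) 0 t) => //.
- by move=> x _; rewrite mulr_ge0 ?powR_ge0// ltW.
- move=> x; rewrite in_itv/= => /andP[_ xt].
  by apply: cvgM; [exact: cvg_cst|exact: continuous_powR_subl].
- move=> x; rewrite in_itv/= => /andP[_ xt].
  rewrite -[X in is_derive _ _ _ X]opprK; apply: is_deriveN.
  exact: is_derive_powR_subl.
- by apply: cvg_at_right_filter; apply: cvgN; exact: continuous_powR_subl.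
- rewrite -oppr0; apply: cvgN.
  by apply: (@cvg_at_left_subl (fun x => x `^ r)); exact: powR_cvg0.
Qed.

Lemma integral_beta2 r s t : 0 < r -> s < t ->
  (\int[mu]_(x in `]s, t[) ((t - x) * (x - s) `^ (r - 1))%R%:E =
   ((t - s) `^ (r + 1) / (r * (r + 1)))%R%:E)%E.
Proof.
move=> r0 st; have ts0 : 0 < t - s by rewrite subr_gt0.
have r1 : 0 < r + 1 by lra.
(* This antiderivative comes from splitting [t - x = (t - s) - (x - s)]. *)
pose F x := (t - s) * r^-1 * (x - s) `^ r - (r + 1)^-1 * (x - s) `^ (r + 1).
have -> : (t - s) `^ (r + 1) / (r * (r + 1)) = F t - 0.
  rewrite subr0 /F powRD; last by rewrite gt_eqF.
  rewrite powRr1 ?ltW//; field.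
  by rewrite !gt_eqF.
have dF x : s < x -> is_derive x 1 F ((t - x) * (x - s) `^ (r - 1)).
  move=> sx.
  have d1 := is_deriveZ ((t - s) * r^-1) (is_derive_powR_subr r sx).
  have d2 := is_deriveZ ((r + 1)^-1) (is_derive_powR_subr (r + 1) sx).
  apply: is_derive_eq (is_deriveB d1 d2) _.
  rewrite addrK -(@mulr_powRB1 _ (x - s) r) ?subr_ge0 ?ltW//.
  rewrite /GRing.scale/=; field.
  by rewrite !gt_eqF.
apply: (@ge0_FTC2_oo R (fun x => (t - x) * (x - s) `^ (r - 1)) F s t 0 (F t)).
- exact: st.
- move=> x; rewrite in_itv/= => /andP[_ xt].
  by rewrite mulr_ge0 ?powR_ge0// subr_ge0 ltW.
- move=> x; rewrite in_itv/= => /andP[sx _].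
  apply: cvgM; last exact: continuous_powR_subr.
  by apply: cvgB; [exact: cvg_cst|exact: cvg_id].
- by move=> x; rewrite in_itv/= => /andP[sx _]; exact: dF.
- rewrite -[X in _ --> X](subrr 0) -[X in _ --> X - _](mulr0 ((t - s) * r^-1)) -[X in _ --> _ - X](mulr0 ((r + 1)^-1)).
  apply: cvgB; apply: cvgM; try exact: cvg_cst.
    by apply: (@cvg_at_right_subr (fun x => x `^ r)); exact: powR_cvg0.
  by apply: (@cvg_at_right_subr (fun x => x `^ (r + 1))); exact: powR_cvg0.
- apply: cvg_at_left_filter; apply/differentiable_continuous/derivable1_diffP.
  exact: (@ex_derive _ _ _ _ _ _ _ (dF _ st)).
Qed.

Lemma integral_expRN t :
  (\int[mu]_(s in `]t, +oo[) (expR (- s))%:E = (expR (- t))%:E)%E.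
Proof.
rewrite integral_itv_obnd_cbnd; last first.
  by apply: measurable_funTS; apply/measurable_EFinP; exact: measurableT_comp.
have dF (x : R) : is_derive x 1 (fun s => - expR (- s)) (expR (- x)).
  have d := @is_derive1_comp R expR -%R x _ _ (is_derive_expR (- x))
    (is_deriveNid x 1).
  by apply: is_derive_eq (is_deriveN d) _; rewrite mulrN1 opprK.
have cN : continuous (fun x : R => expR (- x)).
  by move=> x; apply: continuous_comp;
    [exact: oppr_continuous|exact: continuous_expR].
rewrite (@ge0_continuous_FTC2y R (fun s => expR (- s)) (fun s => - expR (- s)) t 0).
- by rewrite -EFinB sub0r opprK.
- by move=> x _; exact: expR_ge0.
- exact: continuous_subspaceT.
- by rewrite -oppr0; apply: cvgN; exact: cvgr_expR.
- by move=> x _; exact: (@ex_derive _ _ _ _ _ _ _ (dF x)).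
- by apply: cvg_at_right_filter; apply: cvgN; exact: cN.
- by move=> x _; rewrite derive1E; exact: (@derive_val _ _ _ _ _ _ _ (dF x)).
Qed.

End elementary_integrals.

(** * Exchange of the order of integration over [0 < x < y] *)

Section tonelli_triangle.
Context {R : realType}.
Notation mu := (@lebesgue_measure R).

Lemma itv_triangle (b : itv_bound R) (x y : R) :
  (x \in Interval (BRight 0) b) && (y \in Interval (BRight x) b) =
  (y \in Interval (BRight 0) b) && (x \in `]0, y[).
Proof.
case: b => [[|] u|[|]]; rewrite !in_itv/= ?andbF ?andbT//.
- by apply/idP/idP => /andP[/andP[? ?] /andP[? ?]];
    apply/andP; split; apply/andP; split; lra.
- by apply/idP/idP => /andP[/andP[? ?] /andP[? ?]];
    apply/andP; split; apply/andP; split; lra.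
- by apply/idP/idP => /andP[? H]; [|move/andP: H => [? ?]];
    apply/andP; split=> //; try (apply/andP; split=> //); lra.
Qed.

Local Open Scope ereal_scope.

(** The right end [b] is left general: [+oo] serves the functional equation of Gamma, a finite [T]
    the Volterra equation. *)
Lemma tonelli_triangle (b : itv_bound R) (g : R -> R -> \bar R) :
  measurable_fun setT (fun z : R * R => g z.1 z.2) ->
  (forall x y, 0 <= g x y) ->
  \int[mu]_(x in [set` Interval (BRight 0%R) b])
    \int[mu]_(y in [set` Interval (BRight x) b]) g x y =
  \int[mu]_(y in [set` Interval (BRight 0%R) b])
    \int[mu]_(x in `]0%R, y[) g x y.
Proof.
move=> mg g0.
pose c (z : R * R) :=
  (z.2 \in Interval (BRight 0%R) b) && (z.1 \in `]0%R, z.2[).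
(* Extension by zero off the triangle, so that Tonelli's theorem applies on the whole plane. *)
pose F (z : R * R) := if c z then g z.1 z.2 else 0.
have mF : measurable_fun setT F.
  apply: measurable_fun_ifT => //.
  apply: measurable_and; last first.
    under eq_fun do rewrite in_itv/=.
    by apply: measurable_and; exact: measurable_fun_ltr.
  apply: (measurableT_comp (f := fun y : R => y \in Interval (BRight 0%R) b))
    => //.
  apply: (measurable_fun_bool true); rewrite setTI.
  rewrite (_ : _ @^-1` _ = [set` Interval (BRight 0%R) b])//.
have F0 z : 0 <= F z by rewrite /F; case: ifP.
have E := @fubini_tonelli _ _ _ _ _ mu mu F mF F0.
rewrite [LHS]integral_mkcond [RHS]integral_mkcond.
transitivity (\int[mu]_x \int[mu]_y F (x, y)); [|rewrite E];
  apply: eq_integral => x _.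
- rewrite patchE mem_setE; case: ifPn => xb.
    rewrite [LHS]integral_mkcond; apply: eq_integral => y _.
    by rewrite patchE mem_setE /F /c/= -itv_triangle xb.
  by rewrite integral0_eq// => y _; rewrite /F /c/= -itv_triangle (negbTE xb).
- rewrite patchE mem_setE; case: ifPn => xb.
    rewrite [RHS]integral_mkcond; apply: eq_integral => y _.
    by rewrite patchE mem_setE /F /c/= xb.
  by rewrite integral0_eq// => y _; rewrite /F /c/= (negbTE xb).
Qed.

End tonelli_triangle.

(** * The Gamma function *)

Section gamma_function.
Context {R : realType}.
Notation mu := (@lebesgue_measure R).
Implicit Types a t x y : R.

(** Young's inequality for [t ^ a] and [1] with exponents [1 / a] and [1 / (1 - a)]; the right-hand
    side is the tangent at [t = 1]. *)
Lemma powR_le_line a t : 0 <= a <= 1 -> 0 <= t -> t `^ a <= 1 - a + a * t.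
Proof.
move=> /andP[]; rewrite le_eqVlt => /predU1P[<-|a0].
  by rewrite powRr0 mul0r subr0 addr0.
rewrite le_eqVlt => /predU1P[->|a1] t0;
  first by rewrite powRr1// subrr add0r mul1r.
have := @conjugate_powR R (t `^ a) 1 a^-1 (1 - a)^-1.
rewrite powR_ge0 ler01 !invr_gt0 subr_gt0 !invrK (addrC a) subrK mulr1.
move=> /(_ isT isT a0 a1 erefl).
rewrite -powRrM mulfV ?gt_eqF// powRr1// powR1 mul1r; lra.
Qed.

(** Extended-real form of [Gamma], which can be compared and transformed before it is known to be
    finite. *)
Definition eGamma x : \bar R :=
  \int[mu]_(t in `]0%R, +oo[) (t `^ (x - 1) * expR (- t))%R%:E.

Lemma measurable_gamma_fun x :
  measurable_fun setT (fun t => t `^ (x - 1) * expR (- t)).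
Proof.
by apply: measurable_funM; [exact: measurable_powR|exact: measurableT_comp].
Qed.

Lemma gamma_fun_ge0 x t : 0 <= t `^ (x - 1) * expR (- t).
Proof. by rewrite mulr_ge0 ?powR_ge0 ?expR_ge0. Qed.

Lemma eGamma_ge0 x : (0 <= eGamma x)%E.
Proof. by apply: integral_ge0 => t _; rewrite lee_fin gamma_fun_ge0. Qed.

Lemma eGamma1 : eGamma 1 = 1%E.
Proof.
rewrite /eGamma; under eq_integral do rewrite subrr powRr0 mul1r.
by rewrite integral_expRN oppr0 expR0.
Qed.

(* Tonelli applied to [x * t ^ (x - 1) * exp (- s)] on [0 < t < s]. *)
Lemma eGammaS x : 0 < x -> eGamma (x + 1) = (x%:E * eGamma x)%E.
Proof.
move=> x0.
have mx : measurable_fun setT (fun t => x * t `^ (x - 1)).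
  by apply: measurable_funM => //; exact: measurable_powR.
have me : measurable_fun setT (fun s : R => expR (- s)) by exact:
  measurableT_comp.
have x_ge0 t : 0 <= x * t `^ (x - 1) by rewrite mulr_ge0 ?powR_ge0// ltW.
pose g t s := ((x * t `^ (x - 1)) * expR (- s))%:E.
have := @tonelli_triangle R +oo%O g.
have -> : (\int[mu]_(t in `]0%R, +oo[) \int[mu]_(s in `]t, +oo[) g t s =
    x%:E * eGamma x)%E.
  rewrite -ge0_integralZl//=; last 3 first.
  - by apply: measurable_funTS; apply/measurable_EFinP;
      exact: measurable_gamma_fun.
  - by move=> t _; rewrite lee_fin gamma_fun_ge0.
  - by rewrite lee_fin ltW.
  apply: eq_integral => t _; rewrite /g.
  under eq_integral do rewrite EFinM.
  rewrite ge0_integralZl//=.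
  - by rewrite integral_expRN -!EFinM mulrA.
  - by apply: measurable_funTS; apply/measurable_EFinP.
  - by rewrite lee_fin x_ge0.
have -> : (\int[mu]_(s in `]0%R, +oo[) \int[mu]_(t in `]0%R, s[) g t s =
    eGamma (x + 1))%E.
  apply: eq_integral => s; rewrite inE/= in_itv/= andbT => s0; rewrite /g.
  under eq_integral do rewrite EFinM.
  rewrite ge0_integralZr//=.
  - by rewrite integral_powR// addrK.
  - by apply: measurable_funTS; apply/measurable_EFinP.
  - by move=> t _; rewrite lee_fin x_ge0.
move=> ->//.
- apply/measurable_EFinP; apply: measurable_funM.
    exact: (measurableT_comp mx measurable_fst).
  exact: (measurableT_comp me measurable_snd).
- by move=> t s; rewrite lee_fin mulr_ge0// expR_ge0.
Qed.

(** The concave function [t ^ a] lies below its tangent at [y]; this is integrated against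
    [t ^ (x - 1) exp (- t)]. The point [y] is free, to be chosen in each application. *)
Lemma eGammaD_le x y a : 0 < y -> 0 <= a <= 1 ->
  (eGamma (x + a) <=
     (y `^ a * (1 - a))%:E * eGamma x + (y `^ a * (a / y))%:E * eGamma
       (x + 1))%E.
Proof.
move=> y0 a01; have [a0 a1] := andP a01.
have c1 : 0 <= y `^ a * (1 - a) by rewrite mulr_ge0 ?powR_ge0// subr_ge0.
have c2 : 0 <= y `^ a * (a / y) by rewrite mulr_ge0 ?powR_ge0// divr_ge0// ltW.
rewrite -!ge0_integralZl//=; last 4 first.
- by apply: measurable_funTS; apply/measurable_EFinP;
    exact: measurable_gamma_fun.
- by move=> t _; rewrite lee_fin gamma_fun_ge0.
- by apply: measurable_funTS; apply/measurable_EFinP;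
    exact: measurable_gamma_fun.
- by move=> t _; rewrite lee_fin gamma_fun_ge0.
rewrite -ge0_integralD//=; last 4 first.
- by move=> t _; rewrite -EFinM lee_fin mulr_ge0// gamma_fun_ge0.
- apply: measurable_funTS; apply/measurable_EFinP; apply: measurable_funM => //.
  exact: measurable_gamma_fun.
- by move=> t _; rewrite -EFinM lee_fin mulr_ge0// gamma_fun_ge0.
- apply: measurable_funTS; apply/measurable_EFinP; apply: measurable_funM => //.
  exact: measurable_gamma_fun.
apply: ge0_le_integral => //=.
- by move=> t _; rewrite lee_fin gamma_fun_ge0.
- by apply: measurable_funTS; apply/measurable_EFinP;
    exact: measurable_gamma_fun.
- apply: measurable_funTS; apply/measurable_EFinP.
  by apply: measurable_funD; apply: measurable_funM => //;
    exact: measurable_gamma_fun.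
move=> t; rewrite in_itv/= andbT => t0.
rewrite -!EFinM -EFinD lee_fin !mulrA -mulrDl ler_wpM2r ?expR_ge0//.
have ty0 : 0 <= t / y by rewrite divr_ge0// ltW.
have tD r : t `^ (x + r - 1) = t `^ (x - 1) * t `^ r.
  by rewrite addrAC [LHS]powRD//; apply/implyP => _; exact: lt0r_neq0.
have ta : t `^ a = (t / y) `^ a * y `^ a by rewrite -powRM ?divfK ?gt_eqF// ltW.
rewrite !tD ta (powRr1 (ltW t0)).
have := ler_wpM2l (mulr_ge0 (powR_ge0 y a) (powR_ge0 t (x - 1)))
  (powR_le_line a01 ty0).
lra.
Qed.

Lemma eGamma1D_le1 a : 0 <= a <= 1 -> (eGamma (1 + a) <= 1)%E.
Proof.
move=> a01; apply: le_trans (eGammaD_le _ ltr01 a01) _.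
rewrite eGammaS// eGamma1 mul1e !mule1 powR1 !mul1r divr1.
by rewrite -EFinD subrK.
Qed.

(** Induction on an integer above [x], through the functional equation. In the base case [x <= 1],
    the product [x * eGamma x = eGamma (1 + x)] is at most [1]. *)
Lemma eGamma_lty x : 0 < x -> (eGamma x < +oo)%E.
Proof.
move=> x0; have : x <= (Num.truncn x).+1%:R by rewrite ltW// truncnS_gt.
move: (Num.truncn x) => n; elim: n x x0 => [|n IH] x x0 xn; last first.
  have [x1|x1] := lerP x 1; first by apply: IH => //;
    rewrite (le_trans x1)// ler1n.
  have x10 : 0 < x - 1 by rewrite subr_gt0.
  rewrite -(subrK 1 x) eGammaS// lte_mul_pinfty ?lee_fin ?ltW//.
  by rewrite IH// lerBlDr natr1.
have : (eGamma (1 + x) < +oo)%E.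
  by apply: le_lt_trans (ltry 1); apply: eGamma1D_le1; rewrite ltW.
rewrite addrC eGammaS//; apply: contraTT; rewrite -!leNgt !leye_eq => /eqP ->.
by rewrite gt0_muley// lte_fin.
Qed.

Lemma GammaE x : 0 < x -> (Gamma x)%:E = eGamma x.
Proof.
by move=> x0; rewrite /Gamma /Rintegral fineK// ge0_fin_numE ?eGamma_ge0//
  eGamma_lty.
Qed.

Lemma Gamma_ge0 x : 0 <= Gamma x.
Proof. by apply: fine_ge0; exact: eGamma_ge0. Qed.

Lemma GammaS x : 0 < x -> Gamma (x + 1) = x * Gamma x.
Proof.
move=> x0; apply: EFin_inj; rewrite EFinM !GammaE ?eGammaS//; lra.
Qed.

Lemma Gamma1 : Gamma 1 = 1 :> R.
Proof. by apply: EFin_inj; rewrite GammaE// eGamma1. Qed.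

Lemma Gamma1D_le1 a : 0 <= a <= 1 -> Gamma (1 + a) <= 1.
Proof.
move=> a01; rewrite -lee_fin GammaE ?eGamma1D_le1//; lra.
Qed.

(** The tangent is taken at [y = x + a], so that the power has base [1] when [x + a = 1] and base
    [n + 2] when [x = n + 2 - a]. *)
Lemma GammaD_le x a : 0 < x -> 0 <= a <= 1 ->
  Gamma (x + a) <= (x + a) `^ a * Gamma x.
Proof.
move=> x0 a01; have xa : 0 < x + a by lra.
rewrite -lee_fin GammaE//.
apply: le_trans (eGammaD_le _ xa a01) _.
rewrite -!GammaE//; last lra.
rewrite -!EFinM -EFinD lee_fin GammaS// -!mulrA -mulrDr ler_wpM2l ?powR_ge0//.
rewrite -[leRHS]mul1r !mulrA -mulrDl ler_wpM2r ?Gamma_ge0//.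
have : a * (x / (x + a)) <= a * 1.
  rewrite ler_wpM2l ?ler_pdivrMr//; lra.
lra.
Qed.

Lemma Gamma_ge1 x : 0 < x <= 1 -> 1 <= Gamma x.
Proof.
move=> /andP[x0 x1]; have := @GammaD_le x (1 - x) x0.
by rewrite (addrC x) subrK Gamma1 powR1 mul1r; apply; lra.
Qed.

End gamma_function.

(** * Lower bound on [Gamma (2 - a)] by the Euler-Mascheroni constant *)

Section gamma_lower_bound.
Context {R : realType}.
Implicit Types a : R.

Lemma Gamma_nat n : Gamma n.+1%:R = n`!%:R :> R.
Proof.
elim: n => [|n IH]; first by rewrite Gamma1.
by rewrite -natr1 GammaS ?ltr0n// IH factS natrM.
Qed.

(** The functional equation contributes the factors [j - a <= j exp (- a / j)] for [j] from [2] to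
    [n + 1]; the missing [j = 1] explains the [- 1]. *)
Lemma Gamma_prod_le a n : 0 <= a <= 1 -> Gamma (n.+2%:R - a) <=
  Gamma (2 - a) * n.+1`!%:R * expR (- a * (series harmonic n.+1 - 1)).
Proof.
move=> a01; elim: n => [|n IH].
  by rewrite seriesSr /series/= big_geq// add0r invr1 subrr mulr0 expR0 !mulr1.
have n2 : 0 < n.+2%:R :> R by rewrite ltr0n.
have n2' : 2 <= n.+2%:R :> R by rewrite ler_nat.
have n2a : 0 < n.+2%:R - a by lra.
rewrite -[n.+3%:R]natr1 addrAC GammaS//.
apply: (@le_trans _ _ ((n.+2%:R * expR (- a / n.+2%:R)) * Gamma (n.+2%:R - a))).
  rewrite ler_wpM2r ?Gamma_ge0//.
  have -> : n.+2%:R - a = n.+2%:R * (1 + - a / n.+2%:R) by field;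
    rewrite gt_eqF.
  by rewrite ler_wpM2l ?(ltW n2)// expR_ge1Dx.
apply: le_trans (ler_wpM2l _ IH) _; first by rewrite mulr_ge0 ?expR_ge0// ltW.
rewrite [in leRHS]seriesSr (factS n.+1) natrM.
have -> : - a * (series harmonic n.+1 + harmonic n.+1 - 1) =
    - a / n.+2%:R + - a * (series harmonic n.+1 - 1) by rewrite /harmonic/=;
        ring.
by rewrite expRD le_eqVlt; apply/orP; left; apply/eqP; ring.
Qed.

Lemma Gamma_2B_ge_seq a n : 0 <= a <= 1 ->
  expR (a * (euler_seq n.+2 - harmonic n.+1 - 1)) <= Gamma (2 - a).
Proof.
move=> a01.
have n2 : 0 < n.+2%:R :> R by rewrite ltr0n.
have n2' : 2 <= n.+2%:R :> R by rewrite ler_nat.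
have n2a : 0 < n.+2%:R - a by lra.
have := GammaD_le n2a a01; rewrite subrK Gamma_nat => h.
have := le_trans h (ler_wpM2l (powR_ge0 _ _) (Gamma_prod_le n a01)).
rewrite -[X in X `^ a]lnK ?posrE// -expRM.
set A := (X in - a * (X - 1)); set F := n.+1`!%:R.
have F0 : 0 < F by rewrite ltr0n fact_gt0.
have -> : expR (ln n.+2%:R * a) * (Gamma (2 - a) * F * expR (- a * (A - 1))) =
    F * ((expR (ln n.+2%:R * a) * expR (- a * (A - 1))) * Gamma (2 - a))
      by ring.
rewrite -[X in X <= _]mulr1 ler_pM2l// -expRD.
rewrite -ler_pdivrMl ?expR_gt0// mulr1 -expRN; congr (expR _ <= _).
(* The product carries the harmonic sum up to [n + 1] and [euler_seq n.+2] the one up to [n + 2];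
   [harmonic n.+1 = 1 / (n + 2)] makes up the difference. *)
by rewrite /euler_seq seriesSr -/A; ring.
Qed.

Lemma Gamma_2B_ge a : 0 <= a <= 1 ->
  expR (- (a * (1 - euler_mascheroni R))) <= Gamma (2 - a).
Proof.
move=> a01.
have c : expR (a * (euler_seq n.+2 - harmonic n.+1 - 1)) @[n --> \oo] -->
    expR (a * (euler_mascheroni R - 0 - 1)).
  apply: continuous_cvg; first exact: continuous_expR.
  apply: cvgM; first exact: cvg_cst.
  apply: cvgB; last exact: cvg_cst.
  apply: cvgB.
    rewrite (cvg_shiftS (fun n => euler_seq n.+1)) (cvg_shiftS euler_seq).
    exact: cvg_euler_seq.
  by rewrite (cvg_shiftS (@harmonic R)); exact: cvg_harmonic.
have -> : - (a * (1 - euler_mascheroni R)) = a * (euler_mascheroni R - 0 - 1)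
  by ring.
by apply: (cvgr_to_le c); apply: nearW => n; exact: Gamma_2B_ge_seq.
Qed.

End gamma_lower_bound.

(** * Blow-up of the Volterra equation *)

Lemma powRD_gt0 (R : realType) (x r s : R) : 0 < x ->
  x `^ (r + s) = x `^ r * x `^ s.
Proof. by move=> x0; rewrite powRD// lt0r_neq0// implybT. Qed.

Section volterra.
Context {R : realType}.
Notation mu := (@lebesgue_measure R).
Variables (alpha M T : R) (w : R -> R).
Hypothesis alpha0 : 0 < alpha.
Hypothesis alpha1 : alpha < 1.
Hypothesis T0 : 0 < T.
Hypothesis cw : {within `[0, +oo[, continuous w}.
Hypothesis wM : forall t : R, 0 <= t <= T -> 0 <= w t <= M.
Hypothesis wE : forall t : R, 0 <= t <= T ->
  w t = 1 + (Gamma alpha)^-1 *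
    \int[mu]_(tau in `[0, t]) (w tau ^+ 2 / (t - tau) `^ (1 - alpha)).

(** Since [w] is controlled only on [[0, +oo)], its square is extended by zero to be measurable on
    the whole line. *)
Let h : R -> R := (fun t : R => w t ^+ 2) \_ `[0, +oo[.

Let hE (t : R) : 0 <= t -> h t = w t ^+ 2.
Proof. by move=> t0; rewrite /h patchE mem_setE in_itv/= andbT t0. Qed.

Let h_ge0 (t : R) : 0 <= h t.
Proof. by rewrite /h patchE; case: ifP => // _; exact: sqr_ge0. Qed.

Let measurable_w : measurable_fun (`[0, +oo[%classic : set R) w.
Proof. exact: subspace_continuous_measurable_fun. Qed.

Let measurable_h : measurable_fun setT h.
Proof.
apply/(measurable_restrictT _ _).1 => //.
exact: measurable_funX.
Qed.

Let h_le (t : R) : 0 <= t <= T -> h t <= M ^+ 2.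
Proof.
move=> tT; have /andP[t0 _] := tT; have /andP[w0 ?] := wM tT.
by rewrite hE// lerXn2r// nnegrE// (le_trans w0).
Qed.

Let K (t : R) : \bar R :=
  \int[mu]_(tau in `]0%R, t[) (h tau * (t - tau) `^ (alpha - 1))%R%:E.

Let measurable_powR_subl (t r : R) :
  measurable_fun setT (fun tau : R => (t - tau) `^ r).
Proof.
apply: (measurableT_comp (measurable_powR r)).
exact: measurable_funB.
Qed.

Let measurable_h_kernel (t r : R) (D : set R) :
  measurable_fun D (fun tau => (h tau * (t - tau) `^ r)%R%:E).
Proof.
by apply: measurable_funTS; apply/measurable_EFinP; apply: measurable_funM.
Qed.

Let measurable_cst_kernel (c t r : R) (D : set R) :
  measurable_fun D (fun tau => (c * (t - tau) `^ r)%R%:E).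
Proof.
by apply: measurable_funTS; apply/measurable_EFinP; apply: measurable_funM.
Qed.

Let K_ge0 (t : R) : (0 <= K t)%E.
Proof. by apply: integral_ge0 => x _; rewrite lee_fin mulr_ge0 ?powR_ge0. Qed.

(** The kernel has integral [t ^ alpha / alpha] and [h <= M ^ 2]. *)
Let K_lty (t : R) : 0 < t < T -> (K t < +oo)%E.
Proof.
move=> /andP[t0 tT].
apply: (@le_lt_trans _ _ ((M ^+ 2 / alpha)%:E * (t `^ alpha)%:E)%E);
  last by rewrite -EFinM ltry.
rewrite -(integral_powR_subl alpha0 t0) -ge0_integralZl//=; last 3 first.
- exact: measurable_cst_kernel.
- by move=> x _; rewrite lee_fin mulr_ge0 ?powR_ge0// ltW.
- by rewrite lee_fin divr_ge0 ?sqr_ge0// ltW.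
apply: ge0_le_integral => //=.
- by move=> x _; rewrite lee_fin mulr_ge0 ?powR_ge0.
- exact: measurable_h_kernel.
- apply: measurable_funeM; exact: measurable_cst_kernel.
move=> x; rewrite in_itv/= => /andP[x0 xt].
rewrite -EFinM lee_fin mulrA divfK ?gt_eqF// ler_wpM2r ?powR_ge0//.
by apply: h_le; lra.
Qed.

Let Gamma_gt0 : 0 < Gamma alpha.
Proof. by rewrite (lt_le_trans ltr01)// Gamma_ge1// alpha0 ltW. Qed.

(** Finiteness of [K t] matters here: the real-valued integral is the [fine] part of the extended
    one, which would turn [+oo] into [0]. *)
Let KE (t : R) : 0 < t < T -> K t = (Gamma alpha * (w t - 1))%:E.
Proof.
move=> tT; have /andP[t0 t1] := tT.
suff e : (\int[mu]_(x in `[0%R, t]) (w x ^+ 2 / (t - x) `^ (1 - alpha))%R%:E = K t)%E.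
  rewrite wE ?(ltW t0) ?(ltW t1)// addrAC subrr add0r mulVKf ?gt_eqF//.
  by rewrite /Rintegral e fineK// ge0_fin_numE// K_lty.
under eq_integral do rewrite -powRN opprB.
(* Passing to the open interval discards the endpoint [x = t], where the kernel has only a
   conventional value. *)
rewrite integral_itv_bndoo.
  apply: eq_integral => x; rewrite inE/= in_itv/= => /andP[x0 _].
  by rewrite hE ?ltW.
apply/measurable_EFinP; apply: measurable_funM;
  last exact: measurable_funTS (measurable_powR_subl _ _).
apply: measurable_funX; apply: measurable_funS measurable_w => //.
by move=> x /=; rewrite !in_itv/= andbT => /andP[/ltW].
Qed.

Let k : R := (Gamma alpha)^-1 / (alpha * (alpha + 1)).

Let k_gt0 : 0 < k.
Proof. by rewrite /k divr_gt0 ?invr_gt0// mulr_gt0// addr_gt0. Qed.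

Let X : \bar R :=
  \int[mu]_(tau in `]0%R, T[) (h tau * (T - tau) `^ (alpha + 1))%R%:E.

Let weighted_K :
  (\int[mu]_(t in `]0%R, T[) ((T - t)%:E * K t) =
   ((alpha * (alpha + 1))^-1)%:E * X)%E.
Proof.
(* The absolute value makes [g] nonnegative on the whole plane, as Tonelli's theorem requires; for
   [t < T] it changes nothing. *)
pose g (tau t : R) := (h tau * (`|T - t| * (t - tau) `^ (alpha - 1)))%:E.
have mg : measurable_fun setT (fun z : R * R => g z.1 z.2).
  apply/measurable_EFinP; apply: measurable_funM.
    exact: (measurableT_comp measurable_h measurable_fst).
  apply: measurable_funM.
    apply: measurableT_comp => //.
    by apply: measurable_funB => //; exact: measurable_snd.
  apply: (measurableT_comp (measurable_powR (alpha - 1))).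
  by apply: measurable_funB; [exact: measurable_snd|exact: measurable_fst].
have g0 x y : (0 <= g x y)%E by rewrite lee_fin !mulr_ge0 ?powR_ge0.
transitivity (\int[mu]_(t in `]0%R, T[) \int[mu]_(tau in `]0%R, t[) g tau t)%E.
  apply: eq_integral => t; rewrite inE/= in_itv/= => /andP[t0 tT].
  rewrite -ge0_integralZl//=; last 3 first.
  - exact: measurable_h_kernel.
  - by move=> x _; rewrite lee_fin mulr_ge0 ?powR_ge0.
  - by rewrite lee_fin subr_ge0 ltW.
  apply: eq_integral => x _; rewrite -EFinM /g ger0_norm ?subr_ge0 ?ltW//.
  by rewrite mulrCA.
rewrite -tonelli_triangle// -ge0_integralZl//=; last 3 first.
- exact: measurable_h_kernel.
- by move=> x _; rewrite lee_fin mulr_ge0 ?powR_ge0.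
- by rewrite lee_fin invr_ge0 mulr_ge0 ?addr_ge0// ltW.
apply: eq_integral => x; rewrite inE/= in_itv/= => /andP[x0 xT].
transitivity (\int[mu]_(t in `]x, T[) ((h x)%:E * ((T - t) * (t - x) `^ (alpha - 1))%R%:E))%E.
  apply: eq_integral => t; rewrite inE/= in_itv/= => /andP[xt tT].
  by rewrite -EFinM /g ger0_norm ?subr_ge0 ?ltW.
rewrite ge0_integralZl//=.
- by rewrite integral_beta2// -!EFinM; congr EFin; rewrite mulrA mulrC.
- apply: measurable_funTS; apply/measurable_EFinP; apply: measurable_funM.
    exact: measurable_funB.
  apply: (measurableT_comp (measurable_powR (alpha - 1))).
  exact: measurable_funB.
- move=> t; rewrite in_itv/= => /andP[xt tT].
  by rewrite lee_fin mulr_ge0 ?powR_ge0// subr_ge0 ltW.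
- by rewrite lee_fin.
Qed.

(** Finiteness is what later allows [k X] to be cancelled. It follows from [h <= M ^ 2] and [(T - x)
    ^ (alpha + 1) <= T (T - x) ^ alpha]. *)
Let X_fin : X \is a fin_num.
Proof.
rewrite ge0_fin_numE; last first.
  by apply: integral_ge0 => x _; rewrite lee_fin mulr_ge0 ?powR_ge0.
apply: (@le_lt_trans _ _ ((M ^+ 2 * T / (alpha + 1))%:E * (T `^ (alpha + 1))%:E)%E); last by rewrite -EFinM ltry.
have a2 : 0 < alpha + 1 by rewrite addr_gt0.
rewrite -(integral_powR_subl a2 T0) -ge0_integralZl//=; last 3 first.
- exact: measurable_cst_kernel.
- by move=> x _; rewrite lee_fin mulr_ge0 ?powR_ge0// ltW.
- by rewrite lee_fin divr_ge0 ?(ltW a2)// mulr_ge0 ?sqr_ge0// ltW.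
apply: ge0_le_integral => //=.
- by move=> x _; rewrite lee_fin mulr_ge0 ?powR_ge0.
- exact: measurable_h_kernel.
- apply: measurable_funeM; exact: measurable_cst_kernel.
move=> x; rewrite in_itv/= => /andP[x0 xT].
rewrite -EFinM lee_fin mulrA divfK ?gt_eqF// addrK.
rewrite -(@mulr_powRB1 _ _ (alpha + 1)) ?subr_ge0 ?(ltW xT)// addrK mulrA.
rewrite ler_wpM2r ?powR_ge0// ler_pM// ?subr_ge0 ?(ltW xT)//.
  by apply: h_le; rewrite !ltW.
by rewrite gerBl ltW.
Qed.

Let w_ge1 (t : R) : 0 < t < T -> 1 <= w t.
Proof.
by move=> tT; have := K_ge0 t; rewrite KE// lee_fin pmulr_rge0// subr_ge0.
Qed.

Let measurable_weighted_w :
  measurable_fun `]0, T[ (fun t : R => ((T - t) * (w t - 1))%R%:E).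
Proof.
apply/measurable_EFinP; apply: measurable_funM; first exact: measurable_funB.
apply: measurable_funB => //; apply: measurable_funS measurable_w => //.
by move=> x /=; rewrite !in_itv/= andbT => /andP[/ltW].
Qed.

Let weighted_w_ge0 (t : R) : `]0, T[%classic t -> 0 <= (T - t) * (w t - 1).
Proof.
rewrite /= in_itv/= => tT; have /andP[_ /ltW t1] := tT.
by rewrite mulr_ge0 ?subr_ge0// w_ge1.
Qed.

Let weighted_w :
  (\int[mu]_(t in `]0%R, T[) ((T - t) * (w t - 1))%R%:E = k%:E * X)%E.
Proof.
rewrite /k EFinM -muleA -weighted_K.
have -> : (\int[mu]_(t in `]0%R, T[) ((T - t)%:E * K t) =
    (Gamma alpha)%:E * \int[mu]_(t in `]0%R, T[) ((T - t) * (w t - 1))%R%:E)%E.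
  rewrite -ge0_integralZl//=.
  - apply: eq_integral => t; rewrite inE/= in_itv/= => tT.
    by rewrite KE// -!EFinM mulrCA.
  - by rewrite lee_fin ltW.
by rewrite muleA -EFinM mulVf ?gt_eqF// mul1e.
Qed.

Let young (s u : R) : 0 < s ->
  s * u <= k * (u ^+ 2 * s `^ (alpha + 1)) + (4 * k)^-1 * s `^ (1 - alpha).
Proof.
move=> s0; set p := s `^ alpha.
have p0 : 0 < p by exact: powR_gt0.
have -> : s `^ (alpha + 1) = s * p by rewrite powRD_gt0// powRr1 ?ltW// mulrC.
have -> : s `^ (1 - alpha) = s / p by rewrite powRD_gt0// powRr1 ?ltW// powRN.
rewrite -subr_ge0.
have -> : k * (u ^+ 2 * (s * p)) + (4 * k)^-1 * (s / p) - s * u =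
    s * (2 * k * p * u - 1) ^+ 2 / (4 * k * p).
  by field; rewrite !gt_eqF.
apply: divr_ge0; last by apply/ltW/mulr_gt0 => //; exact: mulr_gt0.
by rewrite mulr_ge0 ?sqr_ge0// ltW.
Qed.

Lemma volterra_bound : T `^ alpha <= (2 * k * (2 - alpha))^-1.
Proof.
(* On the left, [k X] is the integral of [(T - t) (w t - 1)] and [T ^ 2 / 2] that of [T - t];
   together they give [(T - t) w t], to which [young] applies pointwise. *)
have main : (k%:E * X + (T ^+ 2 / 2)%:E <=
    k%:E * X + ((4 * k)^-1 * (T `^ (2 - alpha) / (2 - alpha)))%:E)%E.
  have a2 : 0 < 2 - alpha by rewrite subr_gt0 (lt_trans alpha1)// ltr1n.
  have <- : (\int[mu]_(t in `]0%R, T[) (T - t)%:E = (T ^+ 2 / 2)%:E)%E.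
    have := integral_beta2 ltr01 T0.
    rewrite subr0 !mul1r -[1 + 1]/(2%:R) powR_mulrn ?ltW// => <-.
    by apply: eq_integral => t _; rewrite subrr powRr0 mulr1.
  rewrite -[X in (X + _ <= _)%E]weighted_w -ge0_integralD//=; last 2 first.
  - by move=> t; rewrite in_itv/= => /andP[_ /ltW tT]; rewrite lee_fin subr_ge0.
  - by apply: measurable_funTS; apply/measurable_EFinP; exact: measurable_funB.
  have <- : (\int[mu]_(t in `]0%R, T[) ((4 * k)^-1 * (T - t) `^ (1 - alpha))%R%:E =
      ((4 * k)^-1 * (T `^ (2 - alpha) / (2 - alpha)))%:E)%E.
    transitivity (((4 * k)^-1 / (2 - alpha))%:E * (T `^ (2 - alpha))%:E)%E;
      last first.
      by rewrite -EFinM; congr EFin; rewrite [RHS]mulrA mulrAC.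
    rewrite -(integral_powR_subl a2 T0).
    rewrite -ge0_integralZl//=; last 3 first.
    + exact: measurable_cst_kernel.
    + by move=> t _; rewrite lee_fin mulr_ge0 ?powR_ge0// ltW.
    + by rewrite lee_fin divr_ge0 ?(ltW a2)// invr_ge0 mulr_ge0// ltW.
    apply: eq_integral => t _.
    rewrite -[RHS]EFinM; congr EFin; rewrite [RHS]mulrA divfK ?gt_eqF//.
    by congr (_ * _ `^ _); ring.
  rewrite -ge0_integralZl//=; last 3 first.
  - exact: measurable_h_kernel.
  - by move=> t _; rewrite lee_fin mulr_ge0 ?powR_ge0.
  - by rewrite lee_fin ltW.
  rewrite -ge0_integralD//=; last 4 first.
  - move=> t _; rewrite -EFinM lee_fin; apply: mulr_ge0; first exact: ltW.
    by rewrite mulr_ge0 ?powR_ge0.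
  - by apply: measurable_funeM; exact: measurable_h_kernel.
  - by move=> t _; rewrite lee_fin mulr_ge0 ?powR_ge0// invr_ge0 ltW// mulr_gt0.
  - exact: measurable_cst_kernel.
  apply: ge0_le_integral => //=.
  - move=> t tT; rewrite -EFinD lee_fin addr_ge0 ?weighted_w_ge0//.
    by move: tT; rewrite in_itv/= => /andP[_ /ltW tT]; rewrite subr_ge0.
  - apply: emeasurable_funD => //.
    by apply: measurable_funTS; apply/measurable_EFinP; exact: measurable_funB.
  - apply: emeasurable_funD; last exact: measurable_cst_kernel.
    by apply: measurable_funeM; exact: measurable_h_kernel.
  move=> t; rewrite in_itv/= => /andP[t0 tT].
  rewrite -EFinM -!EFinD lee_fin hE ?(ltW t0)//.
  have -> : (T - t) * (w t - 1) + (T - t) = (T - t) * w t by ring.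
  by apply: young; rewrite subr_gt0.
move: main; rewrite leeD2lE ?fin_numM// lee_fin.
have -> : T ^+ 2 = T `^ (2 - alpha) * T `^ alpha.
  by rewrite -powRD_gt0// subrK powR_mulrn// ltW.
have T2 : 0 < T `^ (2 - alpha) by exact: powR_gt0.
rewrite mulrCA -mulrA ler_pM2l// => Ta.
have a2 : 0 < 2 - alpha by rewrite subr_gt0 (lt_trans alpha1)// ltr1n.
have -> : (2 * k * (2 - alpha))^-1 = 2 * ((4 * k)^-1 / (2 - alpha)).
  by field; rewrite !gt_eqF.
by rewrite mulrC -ler_pdivrMr.
Qed.

End volterra.

(** * From the a priori estimate to the blow-up time *)

Section blowup.
Context {R : realType}.
Implicit Types (alpha T : R) (M : nat).

Lemma trunc_solution_ge1 alpha M (w : R -> R) t :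
  trunc_solution alpha M w -> 0 <= t -> 1 <= w t.
Proof.
move=> [_ wE] t0; rewrite wE// lerDl mulr_ge0 ?invr_ge0 ?Gamma_ge0//.
apply: Rintegral_ge0 => x _; rewrite divr_ge0 ?powR_ge0//.
by rewrite /trunc_sqr le_min !exprn_even_ge0.
Qed.

Lemma trunc_solution_existence_time alpha M (w : R -> R) T :
  0 < alpha < 1 -> 0 < T -> trunc_solution alpha M w ->
  (forall t, 0 <= t <= T -> w t <= M%:R) ->
  T `^ alpha <= (Gamma (2 - alpha))^-1.
Proof.
move=> /andP[a0 a1] T0 sol wM; have [cw wE] := sol.
have w0 t : 0 <= t -> 0 <= w t.
  by move=> t0; rewrite (le_trans ler01)// (trunc_solution_ge1 sol).
have G2 : 0 < Gamma (2 - alpha).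
  by apply: lt_le_trans (expR_gt0 _) (Gamma_2B_ge _); lra.
have G1 : 0 < Gamma alpha by apply: (lt_le_trans ltr01); apply: Gamma_ge1; lra.
have := @volterra_bound R alpha M%:R T w a0 a1 T0 cw.
move=> /(_ _)/(_ _) h.
apply: (le_trans (h _ _)).
- by move=> t /[dup] tT /andP[t0 _]; rewrite w0// wM.
- move=> t /andP[t0 tT]; rewrite wE//; congr (_ + _ * _).
  apply: eq_Rintegral => x; rewrite inE/= in_itv/= => /andP[x0 xt].
  (* As [0 <= w <= M] on [[0, T]], the truncation is inactive there. *)
  rewrite /trunc_sqr min_l// lerXn2r ?nnegrE ?w0 ?ler0n// wM// x0.
  exact: le_trans xt tT.
have gS : alpha * Gamma alpha = Gamma (1 + alpha) by rewrite addrC GammaS.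
have g1 : Gamma (1 + alpha) <= 1 by apply: Gamma1D_le1; lra.
have g2 : Gamma (2 - alpha) <= 1.
  have -> : 2 - alpha = 1 + (1 - alpha) by ring.
  by apply: Gamma1D_le1; lra.
move: (Gamma (2 - alpha)) (Gamma alpha) (Gamma (1 + alpha)) G2 G1 gS g1 g2.
move=> q p g q0 p0 gE g1 q1.
have a10 : 0 < alpha + 1 by lra.
have a20 : 0 < 2 - alpha by lra.
have g0 : 0 < g by rewrite -gE mulr_gt0.
have -> : 2 * (p^-1 / (alpha * (alpha + 1))) * (2 - alpha) =
    2 * (2 - alpha) / (g * (alpha + 1)).
  by rewrite -gE; field; rewrite !gt_eqF.
rewrite lef_pV2 ?posrE ?divr_gt0 ?mulr_gt0// ler_pdivlMr ?mulr_gt0//.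
(* What remains is [q g (alpha + 1) <= 2 (2 - alpha)], and [alpha + 1 <= 2 (2 - alpha)] holds
   because [alpha < 1]. *)
have gq : g * q <= 1 by rewrite mulr_ile1// ltW.
by have := ler_wpM2r (ltW a10) gq; lra.
Qed.

(** Were the blow-up time larger, some [T > B] would see all the [vM M] below a common finite bound
    on [[0, T]]. Any [M] above that bound then contradicts the hypothesis. *)
Lemma blowup_time_le (vM : nat -> R -> R) (B : R) : 0 <= B ->
  (forall M T, (4 <= M)%N -> 0 < T ->
    (forall t, 0 <= t <= T -> vM M t <= M%:R) -> T <= B) ->
  (blowup_time (sup_solution vM) <= B%:E)%E.
Proof.
move=> B0 H; rewrite leNgt; apply/negP => /ereal_sup_gt[S [S0 Sb] BS].
have [T BT TS] : exists2 T, B < T & (T%:E < S)%E.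
  case: S S0 Sb BS => [r _ _|_ _ _|//]; last by exists (B + 1);
    rewrite ?ltry// ltrDl.
  by rewrite lte_fin => Br; exists ((B + r) / 2); rewrite ?lte_fin; lra.
have T0 : 0 < T by exact: le_lt_trans BT.
have := Sb T T0 TS; set s := ereal_sup _ => soo.
have vs M t : (4 <= M)%N -> 0 <= t <= T -> ((vM M t)%:E <= s)%E.
  move=> M4 tT; apply: (@le_trans _ _ (sup_solution vM t)).
    by apply: ereal_sup_ubound; exists M.
  by apply: ereal_sup_ubound; exists t => //=; rewrite in_itv.
have s_fin : s \is a fin_num.
  rewrite fin_numElt soo andbT (lt_le_trans _ (vs 4 0 _ _)) ?ltNyr// lexx.
  exact: ltW.
(* Adding [4] both exceeds the supremum and ensures [4 <= M]. *)
pose M := (Num.truncn `|fine s|).+4.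
have : T <= B.
  apply: (H M T) => // t tT; rewrite -lee_fin (le_trans (vs M t _ tT))//.
  rewrite -(fineK s_fin) lee_fin (le_trans (ler_norm _))//.
  rewrite ltW// (lt_le_trans (truncnS_gt _))// ler_nat /M.
  by rewrite !ltnS; do 3 apply: leqW.
by rewrite leNgt BT.
Qed.

End blowup.

Theorem theorem1p4 (R : realType) :
  (forall (alpha : R) (vM : nat -> R -> R),
     0 < alpha < 1 ->
     (forall M : nat, (4 <= M)%N -> trunc_solution alpha M (vM M)) ->
     (blowup_time (sup_solution vM)
        <= (((Gamma (2 - alpha))^-1) `^ (alpha^-1))%:E)%E /\
     (blowup_time (sup_solution vM)
        <= (expR (1 - euler_mascheroni R))%:E)%E) /\
  (* the decimal expansion of e^(1 - gamma) starts with 1.52620511 *)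
  152620511%:R / (10 ^+ 8) <= expR (1 - euler_mascheroni R)
    < 152620512%:R / (10 ^+ 8).
Proof.
split; last exact: expR_1Beuler.
move=> alpha vM a01 sol; have /andP[a0 a1] := a01.
have bound : (blowup_time (sup_solution vM)
    <= (((Gamma (2 - alpha))^-1) `^ (alpha^-1))%:E)%E.
  apply: blowup_time_le => [|M T M4 T0 vT]; first exact: powR_ge0.
  have := trunc_solution_existence_time a01 T0 (sol M M4) vT.
  have ai : 0 <= alpha^-1 by rewrite invr_ge0 ltW.
  move/(ge0_ler_powR ai); rewrite !nnegrE powR_ge0 invr_ge0 Gamma_ge0.
  by move=> /(_ isT isT); rewrite -powRrM mulfV ?gt_eqF// powRr1 ?(ltW T0).
split; first exact: bound.
apply: le_trans bound _; rewrite lee_fin.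
have h : expR (- (alpha * (1 - euler_mascheroni R))) <= Gamma (2 - alpha).
  by apply: Gamma_2B_ge; lra.
have G2 : 0 < Gamma (2 - alpha) by exact: lt_le_trans (expR_gt0 _) h.
(* Written as a power [1 / alpha], the second bound is compared with the first through monotonicity
   of that power. *)
have -> : expR (1 - euler_mascheroni R) =
    (expR (alpha * (1 - euler_mascheroni R))) `^ alpha^-1.
  by rewrite -expRM mulrAC mulfV ?gt_eqF// mul1r.
apply: ge0_ler_powR; rewrite ?nnegrE ?invr_ge0 ?expR_ge0 ?Gamma_ge0 ?(ltW a0)//.
by rewrite -[leRHS]invrK -expRN lef_pV2 ?posrE ?expR_gt0.
Qed.
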